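(* Let $(\mathcal D_1,\otimes,\mathbb S_1)$ and $(\mathcal D_2,\otimes,\mathbb S_2)$ be two closed tensor-triangulated categories, both having products and coproducts, and let $\varphi^*\dashv\varphi_*\dashv\varphi^!$ be an adjoint triple of triangle functors, with $\varphi_*:\mathcal D_2\to\mathcal D_1$ and $\varphi^*,\varphi^!:\mathcal D_1\to\mathcal D_2$, such that $\varphi^*\dashv\varphi_*$ is a monoidal adjunction. Suppose that $\mathbb S_1$ and $\mathbb S_2$ are silting objects of $\mathcal D_1$, respectively $\mathcal D_2$, and that $\mathcal D_1=\mathrm{Loc}(\mathbb S_1)$ (under these hypotheses $\varphi^*$ sends silting objects to silting objects and $\varphi^!$ sends cosilting objects to cosilting objects). Then: (1) if $T_1,T_1'\in\mathcal D_1$ are two equivalent silting objects, then the induced silting objects $T_2=\varphi^*T_1$ and $T_2'=\varphi^*T_1'$ in $\mathcal D_2$ are also equivalent; (2) if $C_1,C_1'\in\mathcal D_1$ are two equivalent cosilting objects, then the induced cosilting objects $C_2=\varphi^!C_1$ and $C_2'=\varphi^!C_1'$ in $\mathcal D_2$ are also equivalent.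
   Context: For an object $X$ of a triangulated category $\mathcal D$ and $N\subseteq\mathbb Z$, $X[N]=\{X[n]\mid n\in N\}$; $[<0]$, $[\ge 0]$, etc. denote the corresponding subsets $N$. For a class $\mathcal X$ of objects, $\mathcal X^\perp=\{Y\mid \mathcal D(X,Y)=0\ \forall X\in\mathcal X\}$ and ${}^\perp\mathcal X=\{Y\mid\mathcal D(Y,X)=0\ \forall X\in\mathcal X\}$; ${}^\perp C[N]$ means ${}^\perp(C[N])$. A torsion pair in $\mathcal D$ is a pair $(\mathcal U,\mathcal V)$ of full subcategories closed under direct summands with $\mathcal D(\mathcal U,\mathcal V)=0$ such that every $X$ lies in a triangle $U\to X\to V\to U[1]$ with $U\in\mathcal U$, $V\in\mathcal V$; it is a t-structure if $\mathcal U[1]\subseteq\mathcal U$. If $\mathcal D$ has coproducts, $T\in\mathcal D$ is silting if $(T[<0]^\perp,T[\ge0]^\perp)$ is a t-structure (the silting t-structure of $T$). If $\mathcal D$ has products, $C\in\mathcal D$ is cosilting if $({}^\perp C[\le0],{}^\perp C[>0])$ is a t-structure (the cosilting t-structure of $C$). Two (co)silting objects are equivalent if they induce the same (co)silting t-structure. $\mathrm{Loc}(X)$ is the smallest triangulated subcategory closed under coproducts containing $X$. A tensor-triangulated category is a triangulated category with a symmetric monoidal structure whose tensor product is triangulated in both variables; it is closed if each $-\otimes X$ has a right adjoint $\hom(X,-)$. An adjunction $\varphi^*\dashv\varphi_*$ between symmetric monoidal categories is monoidal if $\varphi^*$ is strong monoidal. *)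

(* Defs.v *)
From mathcomp Require Import all_boot all_order all_algebra.

Set Implicit Arguments.
Unset Strict Implicit.
Unset Printing Implicit Defensive.

Import Order.TTheory GRing.Theory Num.Theory.
Local Open Scope ring_scope.

Declare Scope cat_scope.
Delimit Scope cat_scope with cat.
Open Scope cat_scope.

Reserved Notation "g ∘ f" (at level 40, left associativity).
Reserved Notation "A ⊗ B" (at level 38, left associativity).
Reserved Notation "f ⊗h g" (at level 38, left associativity).

Record preadditive := Preadditive {
  ob :> Type;
  mor : ob -> ob -> zmodType;
  idm : forall X, mor X X;
  mcomp : forall X Y Z, mor Y Z -> mor X Y -> mor X Z;
  mcompA : forall W X Y Z (h : mor Y Z) (g : mor X Y) (f : mor W X),
    mcomp h (mcomp g f) = mcomp (mcomp h g) f;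
  mcomp1f : forall X Y (f : mor X Y), mcomp (idm Y) f = f;
  mcompf1 : forall X Y (f : mor X Y), mcomp f (idm X) = f;
  mcompDl : forall X Y Z (g g' : mor Y Z) (f : mor X Y),
    mcomp (g + g') f = mcomp g f + mcomp g' f;
  mcompDr : forall X Y Z (g : mor Y Z) (f f' : mor X Y),
    mcomp g (f + f') = mcomp g f + mcomp g f'
}.
Arguments mor {p} X Y.
Arguments idm {p} X.
Arguments mcomp {p X Y Z} _ _.

Notation "g ∘ f" := (mcomp g f) : cat_scope.

Section InCategory.
Variable C : preadditive.

Definition is_iso (X Y : C) (f : mor X Y) : Prop :=
  exists g : mor Y X, g ∘ f = idm X /\ f ∘ g = idm Y.

Definition isomorphic (X Y : C) : Prop := exists f : mor X Y, is_iso f.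

Definition is_zero (Z : C) : Prop :=
  (forall X (f : mor X Z), f = 0) /\ (forall X (f : mor Z X), f = 0).

Definition is_biproduct (A B P : C) (i1 : mor A P) (i2 : mor B P)
    (p1 : mor P A) (p2 : mor P B) : Prop :=
  [/\ p1 ∘ i1 = idm A, p2 ∘ i2 = idm B, p1 ∘ i2 = 0, p2 ∘ i1 = 0
    & i1 ∘ p1 + i2 ∘ p2 = idm P].

Definition is_summand (A X : C) : Prop :=
  exists (B : C) (i1 : mor A X) (i2 : mor B X) (p1 : mor X A) (p2 : mor X B),
    is_biproduct i1 i2 p1 p2.

(** [small] is the universe of the index sets of products and coproducts; it is
    made large enough to contain the hom-sets, whereas nothing relates it to
    the universe of the objects. *)
Definition small := Type.
Definition mor_small (X Y : C) : small := mor X Y.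

Definition is_coproduct (I : small) (X : I -> C) (P : C)
    (inj : forall i, mor (X i) P) : Prop :=
  forall (Y : C) (f : forall i, mor (X i) Y),
    exists! g : mor P Y, forall i, g ∘ inj i = f i.

Definition is_product (I : small) (X : I -> C) (P : C)
    (prj : forall i, mor P (X i)) : Prop :=
  forall (Y : C) (f : forall i, mor Y (X i)),
    exists! g : mor Y P, forall i, prj i ∘ g = f i.

Definition has_coproducts : Prop :=
  forall (I : small) (X : I -> C),
    exists (P : C) (inj : forall i, mor (X i) P), is_coproduct inj.

Definition has_products : Prop :=
  forall (I : small) (X : I -> C),
    exists (P : C) (prj : forall i, mor P (X i)), is_product prj.

Definition additive_axiom : Prop :=
  (exists Z : C, is_zero Z) /\
  (forall A B : C, exists (P : C) (i1 : mor A P) (i2 : mor B P)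
     (p1 : mor P A) (p2 : mor P B), is_biproduct i1 i2 p1 p2).

End InCategory.

Record functor (C D : preadditive) := Functor {
  fob :> C -> D;
  fmap : forall X Y : C, mor X Y -> mor (fob X) (fob Y);
  fmap1 : forall X : C, fmap (idm X) = idm (fob X);
  fmapM : forall (X Y Z : C) (g : mor Y Z) (f : mor X Y),
    fmap (g ∘ f) = fmap g ∘ fmap f
}.
Arguments fmap {C D} _ {X Y} _.

Definition additive_functor (C D : preadditive) (F : functor C D) : Prop :=
  forall (X Y : C) (f g : mor X Y), fmap F (f + g) = fmap F f + fmap F g.

Definition idF (C : preadditive) : functor C C :=
  @Functor C C (fun X => X) (fun _ _ f => f)
    (fun _ => erefl) (fun _ _ _ _ _ => erefl).

Section CompF.
Variables (C D E : preadditive) (G : functor D E) (F : functor C D).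

Fact compF_1 (X : C) : fmap G (fmap F (idm X)) = idm (G (F X)).
Proof. by rewrite !fmap1. Qed.

Fact compF_M (X Y Z : C) (g : mor Y Z) (f : mor X Y) :
  fmap G (fmap F (g ∘ f)) = fmap G (fmap F g) ∘ fmap G (fmap F f).
Proof. by rewrite !fmapM. Qed.

Definition compF : functor C E :=
  @Functor C E (fun X => G (F X)) (fun _ _ f => fmap G (fmap F f))
    compF_1 compF_M.

End CompF.

Definition natural (C D : preadditive) (F G : functor C D)
    (t : forall X, mor (F X) (G X)) : Prop :=
  forall (X Y : C) (f : mor X Y), t Y ∘ fmap F f = fmap G f ∘ t X.

Record natiso (C D : preadditive) (F G : functor C D) := NatIso {
  ni :> forall X : C, mor (F X) (G X);
  ni_nat : natural ni;
  ni_iso : forall X, is_iso (ni X)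
}.

(** [adjunction F G] is the datum of an adjunction F ⊣ G. *)
Record adjunction (C D : preadditive) (F : functor C D) (G : functor D C) :=
  Adjunction {
  adj_unit : forall X : C, mor X (G (F X));
  adj_counit : forall Y : D, mor (F (G Y)) Y;
  adj_unit_nat : natural (F := idF C) (G := compF G F) adj_unit;
  adj_counit_nat : natural (F := compF F G) (G := idF D) adj_counit;
  adj_triangle_l : forall X : C,
    adj_counit (F X) ∘ fmap F (adj_unit X) = idm (F X);
  adj_triangle_r : forall Y : D,
    fmap G (adj_counit Y) ∘ adj_unit (G Y) = idm (G Y)
}.

(** [dist u v w] says that X -u-> Y -v-> Z -w-> X[1] is a distinguished
    triangle. The shift is an additive autoequivalence with a chosen
    quasi-inverse. *)
Record triangulated := Triangulated {
  tri_cat :> preadditive;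
  tri_additive : additive_axiom tri_cat;
  shift : functor tri_cat tri_cat;
  unshift : functor tri_cat tri_cat;
  shift_additive : additive_functor shift;
  shift_unshift : natiso (compF shift unshift) (idF tri_cat);
  unshift_shift : natiso (compF unshift shift) (idF tri_cat);
  dist : forall X Y Z : tri_cat,
    mor X Y -> mor Y Z -> mor Z (shift X) -> Prop;
  tr1_iso : forall (X Y Z X' Y' Z' : tri_cat)
      (u : mor X Y) (v : mor Y Z) (w : mor Z (shift X))
      (u' : mor X' Y') (v' : mor Y' Z') (w' : mor Z' (shift X'))
      (f : mor X X') (g : mor Y Y') (h : mor Z Z'),
    is_iso f -> is_iso g -> is_iso h ->
    g ∘ u = u' ∘ f -> h ∘ v = v' ∘ g -> fmap shift f ∘ w = w' ∘ h ->
    dist u v w -> dist u' v' w';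
  tr1_id : forall X Z : tri_cat, is_zero Z ->
    dist (idm X) (0 : mor X Z) (0 : mor Z (shift X));
  tr1_cone : forall (X Y : tri_cat) (u : mor X Y),
    exists (Z : tri_cat) (v : mor Y Z) (w : mor Z (shift X)), dist u v w;
  tr2 : forall (X Y Z : tri_cat)
      (u : mor X Y) (v : mor Y Z) (w : mor Z (shift X)),
    dist u v w <-> dist v w (- fmap shift u);
  tr3 : forall (X Y Z X' Y' Z' : tri_cat)
      (u : mor X Y) (v : mor Y Z) (w : mor Z (shift X))
      (u' : mor X' Y') (v' : mor Y' Z') (w' : mor Z' (shift X'))
      (f : mor X X') (g : mor Y Y'),
    dist u v w -> dist u' v' w' -> g ∘ u = u' ∘ f ->
    exists h : mor Z Z', h ∘ v = v' ∘ g /\ fmap shift f ∘ w = w' ∘ h;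
  tr4 : forall (X Y Z Z' X' Y' : tri_cat)
      (u : mor X Y) (i : mor Y Z') (i' : mor Z' (shift X))
      (v : mor Y Z) (j : mor Z X') (j' : mor X' (shift Y))
      (k : mor Z Y') (k' : mor Y' (shift X)),
    dist u i i' -> dist v j j' -> dist (v ∘ u) k k' ->
    exists (f : mor Z' Y') (g : mor Y' X'),
      [/\ dist f g (fmap shift i ∘ j'),
          f ∘ i = k ∘ v, k' ∘ f = i', g ∘ k = j
        & j' ∘ g = fmap shift u ∘ k']
}.
Arguments shift {t}.
Arguments unshift {t}.
Arguments dist {t X Y Z} _ _ _.

Record triangle_functor (C D : triangulated) (F : functor C D) :=
  TriangleFunctor {
  tf_additive : additive_functor F;
  tf_shift : natiso (compF F shift) (compF shift F);
  tf_dist : forall (X Y Z : C)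
      (u : mor X Y) (v : mor Y Z) (w : mor Z (shift X)),
    dist u v w -> dist (fmap F u) (fmap F v) (tf_shift X ∘ fmap F w)
}.

Section InTriangulated.
Variable D : triangulated.

(** Used instead of [iter], which would bound the universe of the objects. *)
Fixpoint fiter (F : functor D D) (k : nat) (X : D) : D :=
  if k is k'.+1 then F (fiter F k' X) else X.

Definition shiftn (X : D) (n : int) : D :=
  match n with
  | Posz k => fiter shift k X
  | Negz k => fiter unshift k.+1 X
  end.

(** Full subcategories are given by classes of objects. *)
Definition class := D -> Prop.

Definition same_class (P Q : class) : Prop := forall X, P X <-> Q X.

Definition shifts (X : D) (N : int -> bool) : class :=
  fun Y => exists n : int, N n /\ Y = shiftn X n.

Definition perp_r (P : class) : class :=
  fun Y => forall X, P X -> forall f : mor X Y, f = 0.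

Definition perp_l (P : class) : class :=
  fun Y => forall X, P X -> forall f : mor Y X, f = 0.

Definition torsion_pair (U V : class) : Prop :=
  [/\ forall A X, is_summand A X -> U X -> U A,
      forall A X, is_summand A X -> V X -> V A,
      forall X Y, U X -> V Y -> forall f : mor X Y, f = 0
    & forall X, exists (A B : D) (u : mor A X) (v : mor X B)
        (w : mor B (shift A)), [/\ U A, V B & dist u v w]].

Definition t_structure (U V : class) : Prop :=
  torsion_pair U V /\ (forall X, U X -> U (shift X)).

Definition silting_aisle (T : D) : class :=
  perp_r (shifts T (fun n => n < 0)).
Definition silting_coaisle (T : D) : class :=
  perp_r (shifts T (fun n => 0 <= n)).
Definition cosilting_aisle (C : D) : class :=
  perp_l (shifts C (fun n => n <= 0)).
Definition cosilting_coaisle (C : D) : class :=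
  perp_l (shifts C (fun n => 0 < n)).

Definition silting (T : D) : Prop :=
  has_coproducts D /\ t_structure (silting_aisle T) (silting_coaisle T).

Definition cosilting (C : D) : Prop :=
  has_products D /\ t_structure (cosilting_aisle C) (cosilting_coaisle C).

Definition silting_equiv (T T' : D) : Prop :=
  [/\ silting T, silting T',
      same_class (silting_aisle T) (silting_aisle T')
    & same_class (silting_coaisle T) (silting_coaisle T')].

Definition cosilting_equiv (C C' : D) : Prop :=
  [/\ cosilting C, cosilting C',
      same_class (cosilting_aisle C) (cosilting_aisle C')
    & same_class (cosilting_coaisle C) (cosilting_coaisle C')].

(** Full triangulated subcategories are taken to be strict, i.e. closed under
    isomorphism. Closure under cones and both shifts gives two out of three. *)
Definition triangulated_subcategory (P : class) : Prop :=
  [/\ forall X, is_zero X -> P X,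
      forall X Y, isomorphic X Y -> P X -> P Y,
      forall X, P X -> P (shift X),
      forall X, P X -> P (unshift X)
    & forall (X Y Z : D) (u : mor X Y) (v : mor Y Z) (w : mor Z (shift X)),
        dist u v w -> P X -> P Y -> P Z].

Definition coproduct_closed (P : class) : Prop :=
  forall (I : small) (X : I -> D) (Q : D) (inj : forall i, mor (X i) Q),
    is_coproduct inj -> (forall i, P (X i)) -> P Q.

Definition Loc (X : D) : class :=
  fun Y => forall P : class,
    triangulated_subcategory P -> coproduct_closed P -> P X -> P Y.

End InTriangulated.

Record sym_monoidal (C : preadditive) := SymMonoidal {
  tens : C -> C -> C where "A ⊗ B" := (tens A B);
  tensh : forall A A' B B' : C,
    mor A A' -> mor B B' -> mor (A ⊗ B) (A' ⊗ B')
    where "f ⊗h g" := (tensh f g);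
  tensh1 : forall A B : C, idm A ⊗h idm B = idm (A ⊗ B);
  tenshM : forall (A A' A'' B B' B'' : C)
      (f' : mor A' A'') (f : mor A A') (g' : mor B' B'') (g : mor B B'),
    (f' ∘ f) ⊗h (g' ∘ g) = (f' ⊗h g') ∘ (f ⊗h g);
  munit : C;
  massoc : forall A B E : C, mor ((A ⊗ B) ⊗ E) (A ⊗ (B ⊗ E));
  mlunit : forall A : C, mor (munit ⊗ A) A;
  mrunit : forall A : C, mor (A ⊗ munit) A;
  mbraid : forall A B : C, mor (A ⊗ B) (B ⊗ A);
  massoc_nat : forall (A A' B B' E E' : C)
      (f : mor A A') (g : mor B B') (h : mor E E'),
    massoc A' B' E' ∘ ((f ⊗h g) ⊗h h) = (f ⊗h (g ⊗h h)) ∘ massoc A B E;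
  mlunit_nat : forall (A A' : C) (f : mor A A'),
    mlunit A' ∘ (idm munit ⊗h f) = f ∘ mlunit A;
  mrunit_nat : forall (A A' : C) (f : mor A A'),
    mrunit A' ∘ (f ⊗h idm munit) = f ∘ mrunit A;
  mbraid_nat : forall (A A' B B' : C) (f : mor A A') (g : mor B B'),
    mbraid A' B' ∘ (f ⊗h g) = (g ⊗h f) ∘ mbraid A B;
  massoc_iso : forall A B E : C, is_iso (massoc A B E);
  mlunit_iso : forall A : C, is_iso (mlunit A);
  mrunit_iso : forall A : C, is_iso (mrunit A);
  mbraid_sym : forall A B : C, mbraid B A ∘ mbraid A B = idm (A ⊗ B);
  mpentagon : forall A B E F : C,
    massoc A B (E ⊗ F) ∘ massoc (A ⊗ B) E F
    = (idm A ⊗h massoc B E F) ∘ massoc A (B ⊗ E) F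
        ∘ (massoc A B E ⊗h idm F);
  mtriangle : forall A B : C,
    (idm A ⊗h mlunit B) ∘ massoc A munit B = mrunit A ⊗h idm B;
  mhexagon : forall A B E : C,
    (idm B ⊗h mbraid A E) ∘ massoc B A E ∘ (mbraid A B ⊗h idm E)
    = massoc B E A ∘ mbraid A (B ⊗ E) ∘ massoc A B E
}.
Arguments tens {C} _ _ _.
Arguments tensh {C} _ {A A' B B'} _ _.
Arguments munit {C} _.
Arguments massoc {C} _ _ _ _.
Arguments mlunit {C} _ _.
Arguments mrunit {C} _ _.
Arguments mbraid {C} _ _ _.

Section PartialTensor.
Variables (C : preadditive) (M : sym_monoidal C) (A : C).

Fact tens_l_M (X Y Z : C) (g : mor Y Z) (f : mor X Y) :
  tensh M (idm A) (g ∘ f) = tensh M (idm A) g ∘ tensh M (idm A) f.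
Proof. by rewrite -tenshM mcomp1f. Qed.

Fact tens_r_M (X Y Z : C) (g : mor Y Z) (f : mor X Y) :
  tensh M (g ∘ f) (idm A) = tensh M g (idm A) ∘ tensh M f (idm A).
Proof. by rewrite -tenshM mcomp1f. Qed.

(** A ⊗ - *)
Definition tens_l : functor C C :=
  @Functor C C (fun X => tens M A X) (fun _ _ f => tensh M (idm A) f)
    (fun X => tensh1 M A X) tens_l_M.

(** - ⊗ A *)
Definition tens_r : functor C C :=
  @Functor C C (fun X => tens M X A) (fun _ _ f => tensh M f (idm A))
    (fun X => tensh1 M X A) tens_r_M.

End PartialTensor.

Record closed_tt := ClosedTT {
  tt_tri :> triangulated;
  tt_mon : sym_monoidal tt_tri;
  tt_tens_l : forall A : tt_tri, triangle_functor (tens_l tt_mon A);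
  tt_tens_r : forall A : tt_tri, triangle_functor (tens_r tt_mon A);
  ihom : tt_tri -> functor tt_tri tt_tri;
  ihom_adj : forall A : tt_tri, adjunction (tens_r tt_mon A) (ihom A)
}.
Arguments tt_mon : clear implicits.

Definition tunit (D : closed_tt) : D := munit (tt_mon D).
Notation "A ⊗ B" := (tens (tt_mon _) A B) : cat_scope.
Notation "f ⊗h g" := (tensh (tt_mon _) f g) : cat_scope.

Record strong_monoidal (C D : closed_tt) (F : functor C D) := StrongMonoidal {
  sm_unit : mor (tunit D) (F (tunit C));
  sm_tens : forall A B : C, mor (F A ⊗ F B) (F (A ⊗ B));
  sm_unit_iso : is_iso sm_unit;
  sm_tens_iso : forall A B : C, is_iso (sm_tens A B);
  sm_tens_nat : forall (A A' B B' : C) (f : mor A A') (g : mor B B'),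
    sm_tens A' B' ∘ (fmap F f ⊗h fmap F g) = fmap F (f ⊗h g) ∘ sm_tens A B;
  sm_assoc : forall A B E : C,
    fmap F (massoc (tt_mon C) A B E) ∘ sm_tens (A ⊗ B) E
      ∘ (sm_tens A B ⊗h idm (F E))
    = sm_tens A (B ⊗ E) ∘ (idm (F A) ⊗h sm_tens B E)
      ∘ massoc (tt_mon D) (F A) (F B) (F E);
  sm_lunit : forall A : C,
    fmap F (mlunit (tt_mon C) A) ∘ sm_tens (tunit C) A
      ∘ (sm_unit ⊗h idm (F A))
    = mlunit (tt_mon D) (F A);
  sm_runit : forall A : C,
    fmap F (mrunit (tt_mon C) A) ∘ sm_tens A (tunit C)
      ∘ (idm (F A) ⊗h sm_unit)
    = mrunit (tt_mon D) (F A)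
}.

Record monoidal_adjunction (C D : closed_tt)
    (F : functor C D) (G : functor D C) := MonoidalAdjunction {
  ma_adj : adjunction F G;
  ma_monoidal : strong_monoidal F
}.

(* Main.v *)
Require Import Defs.
From Stdlib Require Import IndefiniteDescription.
From mathcomp Require Import all_boot all_algebra.

(** Write F ⊣ G for φ^* ⊣ φ_* and R for G S_2. By adjunction, the (co)aisles of
    F T (of φ^! C) are the preimages under G of those of T (of C), so all that
    has to be shown is that the preimage under G of such a t-structure (U, V) is
    again a t-structure; the same argument covers the silting and the cosilting
    case.
    - R ⊗ U ⊆ U: for u in U and v in V, hom(u, v) lies in the silting coaisle of
      S_1, whereas R lies in its silting aisle.
    - The projection morphism R ⊗ X -> G F X is invertible for all X, since
      D_1 = Loc(S_1); hence G F U ⊆ U.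
    - Given Y, iterate Y_(k+1) = cone(F A_k -> Y_k), where A_k -> G Y_k is the
      coreflection in U. The map G Y_k -> G Y_(k+1) factors through the
      reflection of G Y_k in V, which is the same object for all k. As G
      preserves coproducts, the homotopy colimit Y' satisfies: G Y -> G Y' is
      the reflection of G Y in V. This provides the truncation triangles.
      If G Y is in U, then G Y' = 0, so Y' = 0, as G is conservative; as maps
      from Y to an object of the preimage of V extend to Y', they vanish. *)

Set Implicit Arguments.
Unset Strict Implicit.
Unset Printing Implicit Defensive.

Import GRing.Theory.
Local Open Scope ring_scope.
Local Open Scope cat_scope.

(** * Preadditive categories: isomorphisms, retracts, coproducts *)

Section Preadditive.
Variable C : preadditive.

Lemma mcomp0f (X Y Z : C) (f : mor X Y) : (0 : mor Y Z) ∘ f = 0.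
Proof. by apply: (addrI ((0 : mor Y Z) ∘ f)); rewrite -mcompDl !addr0. Qed.

Lemma mcompf0 (X Y Z : C) (g : mor Y Z) : g ∘ (0 : mor X Y) = 0.
Proof. by apply: (addrI (g ∘ (0 : mor X Y))); rewrite -mcompDr !addr0. Qed.

Lemma mcompNf (X Y Z : C) (g : mor Y Z) (f : mor X Y) : (- g) ∘ f = - (g ∘ f).
Proof. by apply: (addrI (g ∘ f)); rewrite -mcompDl !subrr mcomp0f. Qed.

Lemma mcompfN (X Y Z : C) (g : mor Y Z) (f : mor X Y) : g ∘ (- f) = - (g ∘ f).
Proof. by apply: (addrI (g ∘ f)); rewrite -mcompDr !subrr mcompf0. Qed.

Lemma mcompBl (X Y Z : C) (g g' : mor Y Z) (f : mor X Y) :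
  (g - g') ∘ f = g ∘ f - g' ∘ f.
Proof. by rewrite mcompDl mcompNf. Qed.

Lemma mcompBr (X Y Z : C) (g : mor Y Z) (f f' : mor X Y) :
  g ∘ (f - f') = g ∘ f - g ∘ f'.
Proof. by rewrite mcompDr mcompfN. Qed.

Lemma mcomp_suml (X Y Z : C) n (g : nat -> mor Y Z) (f : mor X Y) :
  (\sum_(j < n) g j) ∘ f = \sum_(j < n) (g j ∘ f).
Proof.
elim: n => [|n IH]; first by rewrite !big_ord0 mcomp0f.
by rewrite !big_ord_recr mcompDl IH.
Qed.

Lemma is_iso_id (X : C) : is_iso (idm X).
Proof. by exists (idm X); rewrite mcomp1f. Qed.

Lemma is_iso_comp (X Y Z : C) (g : mor Y Z) (f : mor X Y) :
  is_iso g -> is_iso f -> is_iso (g ∘ f).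
Proof.
move=> [g' [g1 g2]] [f' [f1 f2]]; exists (f' ∘ g'); split.
  by rewrite -mcompA (mcompA g') g1 mcomp1f.
by rewrite -mcompA (mcompA f) f2 mcomp1f.
Qed.

Lemma isomorphic_refl (X : C) : isomorphic X X.
Proof. by exists (idm X); apply: is_iso_id. Qed.

Lemma isomorphic_sym (X Y : C) : isomorphic X Y -> isomorphic Y X.
Proof. by move=> [f [g [gf fg]]]; exists g, f. Qed.

Lemma isomorphic_trans (Y X Z : C) :
  isomorphic X Y -> isomorphic Y Z -> isomorphic X Z.
Proof. by move=> [f fi] [g gi]; exists (g ∘ f); apply: is_iso_comp. Qed.

Lemma mono_isoK (X Y Z : C) (f : mor Y Z) (g h : mor X Y) :
  is_iso f -> f ∘ g = f ∘ h -> g = h.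
Proof.
by move=> [k [kf _]] e; rewrite -(mcomp1f g) -kf -mcompA e mcompA kf mcomp1f.
Qed.

Lemma is_zero_id (X : C) : idm X = 0 -> is_zero X.
Proof.
move=> e; split=> Y f; first by rewrite -(mcomp1f f) e mcomp0f.
by rewrite -(mcompf1 f) e mcompf0.
Qed.

(** Yoneda, with injectivity tested on zero: a preimage [g] of the identity is a right inverse, and
    [f] kills [g ∘ f - idm A]. *)
Lemma iso_of_bijective (A B : C) (f : mor A B) :
  (forall W (x : mor W B), exists y, f ∘ y = x) ->
  (forall W (y : mor W A), f ∘ y = 0 -> y = 0) -> is_iso f.
Proof.
move=> sur inj; have [g fg] := sur _ (idm B); exists g; split=> //.
by apply/subr0_eq/inj; rewrite mcompBr mcompA fg mcomp1f mcompf1 subrr.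
Qed.

(** A chosen inverse, so that the inverses of a family of maps can be glued over a coproduct. *)
Definition iso_inv (X Y : C) (f : mor X Y) (fi : is_iso f) : mor Y X :=
  proj1_sig (constructive_indefinite_description _ fi).

Lemma iso_invl (X Y : C) (f : mor X Y) (fi : is_iso f) : iso_inv fi ∘ f = idm X.
Proof. by rewrite /iso_inv; case: constructive_indefinite_description => g []. Qed.

Lemma iso_invr (X Y : C) (f : mor X Y) (fi : is_iso f) : f ∘ iso_inv fi = idm Y.
Proof. by rewrite /iso_inv; case: constructive_indefinite_description => g []. Qed.

Definition hom_zero (X Y : C) : Prop := forall f : mor X Y, f = 0.

Lemma hom_zero_iso (X X' Y Y' : C) :
  isomorphic X X' -> isomorphic Y Y' -> hom_zero X Y -> hom_zero X' Y'.
Proof.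
move=> [i [i' [_ i'K]]] [j [j' [_ j'K]]] z f.
have -> : f = j ∘ (j' ∘ f ∘ i) ∘ i'.
  by rewrite !mcompA j'K mcomp1f -mcompA i'K mcompf1.
by rewrite (z (j' ∘ f ∘ i)) mcompf0 mcomp0f.
Qed.

(** Weaker than [is_summand], as no complement is given; every functor preserves it, and orthogonals
    are closed under it. *)
Definition retract (X Y : C) : Prop :=
  exists (i : mor X Y) (r : mor Y X), r ∘ i = idm X.

Definition retract_closed (P : C -> Prop) : Prop :=
  forall X Y, retract X Y -> P Y -> P X.

Lemma isomorphic_retract (X Y : C) : isomorphic X Y -> retract X Y.
Proof. by move=> [f [g [gf _]]]; exists f, g. Qed.

Lemma summand_retract (X Y : C) : is_summand X Y -> retract X Y.
Proof. by move=> [B [i1 [_ [p1 [_ [e _ _ _ _]]]]]]; exists i1, p1. Qed.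

Lemma retract_closed_iso (P : C -> Prop) (X Y : C) :
  retract_closed P -> isomorphic X Y -> P X -> P Y.
Proof. by move=> rP /isomorphic_sym/isomorphic_retract; apply: rP. Qed.

Lemma coproduct_lift (I : small) (X : I -> C) (P : C)
    (inj : forall i, mor (X i) P) (Y : C) (f : forall i, mor (X i) Y) :
  is_coproduct inj -> exists g : mor P Y, forall i, g ∘ inj i = f i.
Proof. by move=> cP; have [g [? _]] := cP Y f; exists g. Qed.

Lemma coproduct_ext (I : small) (X : I -> C) (P : C)
    (inj : forall i, mor (X i) P) (Y : C) (g h : mor P Y) :
  is_coproduct inj -> (forall i, g ∘ inj i = h ∘ inj i) -> g = h.
Proof.
move=> cP e; have [k [_ u]] := cP Y (fun i => h ∘ inj i).
by rewrite -(u g e) -(u h).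
Qed.

End Preadditive.

(** * Equivalences, adjunctions and preservation of coproducts *)

Section Functors.

Lemma fmap_iso (C D : preadditive) (F : functor C D) (X Y : C) (f : mor X Y) :
  is_iso f -> is_iso (fmap F f).
Proof.
by move=> [g [gf fg]]; exists (fmap F g); rewrite -!fmapM gf fg !fmap1.
Qed.

Lemma fmap_isomorphic (C D : preadditive) (F : functor C D) (X Y : C) :
  isomorphic X Y -> isomorphic (F X) (F Y).
Proof. by move=> [f fi]; exists (fmap F f); apply: fmap_iso. Qed.

Lemma fmap0 (C D : preadditive) (F : functor C D) (X Y : C) :
  additive_functor F -> fmap F (0 : mor X Y) = 0.
Proof.
move=> aF; apply: (addrI (fmap F (0 : mor X Y))).
by rewrite -aF !addr0.
Qed.

Lemma fmapN (C D : preadditive) (F : functor C D) (X Y : C) (f : mor X Y) :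
  additive_functor F -> fmap F (- f) = - fmap F f.
Proof.
by move=> aF; apply: (addrI (fmap F f)); rewrite -aF !subrr fmap0.
Qed.

Lemma compF_additive (C D E : preadditive) (G : functor D E) (F : functor C D) :
  additive_functor G -> additive_functor F -> additive_functor (compF G F).
Proof. by move=> aG aF X Y f g /=; rewrite aF aG. Qed.

Lemma fmap_is_zero (C D : preadditive) (F : functor C D) (X : C) :
  additive_functor F -> is_zero X -> is_zero (F X).
Proof.
move=> aF [z _]; apply: is_zero_id.
by rewrite -fmap1 (z _ (idm X)) fmap0.
Qed.

Lemma natiso_faithful (C D : preadditive) (F : functor C D) (G : functor D C)
    (a : natiso (compF G F) (idF C)) (X Y : C)
    (f g : mor X Y) : fmap F f = fmap F g -> f = g.
Proof.
move=> e; have nf := ni_nat a f; have ng := ni_nat a g.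
have [k [_ ak]] := ni_iso a X.
by rewrite /= e in nf; rewrite /= nf in ng; move: ng => /(congr1 (fun h => h ∘ k));
  rewrite -!mcompA ak !mcompf1.
Qed.

(** The preimage is [fmap G h] conjugated by [a]; it is recognised after applying [G], which is
    faithful because of [b]. *)
Lemma natiso_full (C D : preadditive) (F : functor C D) (G : functor D C)
    (a : natiso (compF G F) (idF C))
    (b : natiso (compF F G) (idF D)) (X Y : C) (h : mor (F X) (F Y)) :
  exists f : mor X Y, fmap F f = h.
Proof.
have [k [ka ak]] := ni_iso a X; exists (a Y ∘ fmap G h ∘ k).
apply: (natiso_faithful b).
apply: (mono_isoK (ni_iso a Y)).
have /= -> := ni_nat a (a Y ∘ fmap G h ∘ k).
by rewrite -!mcompA ka mcompf1.
Qed.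

Section Adjunction.
Variables (C D : preadditive) (F : functor C D) (G : functor D C).
Variable adj : adjunction F G.
Hypothesis aF : additive_functor F.

Definition adjL (X : C) (Y : D) (f : mor (F X) Y) : mor X (G Y) :=
  fmap G f ∘ adj_unit adj X.

Definition adjR (X : C) (Y : D) (g : mor X (G Y)) : mor (F X) Y :=
  adj_counit adj Y ∘ fmap F g.

Lemma adjRK (X : C) (Y : D) (f : mor (F X) Y) : adjR (adjL f) = f.
Proof.
rewrite /adjR /adjL fmapM mcompA.
have /= -> := adj_counit_nat adj f.
by rewrite -mcompA adj_triangle_l mcompf1.
Qed.

Lemma adjLK (X : C) (Y : D) (g : mor X (G Y)) : adjL (adjR g) = g.
Proof.
rewrite /adjR /adjL fmapM -mcompA.
have /= <- := adj_unit_nat adj g.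
by rewrite mcompA adj_triangle_r mcomp1f.
Qed.

Lemma adjR0 (X : C) (Y : D) : adjR (0 : mor X (G Y)) = 0.
Proof. by rewrite /adjR fmap0 // mcompf0. Qed.

Lemma adj_hom_zero (X : C) (Y : D) : hom_zero (F X) Y <-> hom_zero X (G Y).
Proof.
split=> z f; last by rewrite -(adjRK f) (z (adjL f)) adjR0.
(* The transposes of [f] and of [0] both vanish, so [f] and [0] agree; this argument replaces
   additivity of [G]. *)
by rewrite -(adjLK f) (z (adjR f)) -(z (adjR 0)) adjLK.
Qed.

Lemma adjL_nat (X' X : C) (Y : D) (f : mor (F X) Y) (h : mor X' X) :
  adjL f ∘ h = adjL (f ∘ fmap F h).
Proof.
rewrite /adjL fmapM -!mcompA.
by have /= -> := adj_unit_nat adj h.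
Qed.

Lemma adjL_nat_r (X : C) (Y Y' : D) (f : mor (F X) Y) (h : mor Y Y') :
  fmap G h ∘ adjL f = adjL (h ∘ f).
Proof. by rewrite /adjL fmapM mcompA. Qed.

Lemma adjL_inj (X : C) (Y : D) (f g : mor (F X) Y) : adjL f = adjL g -> f = g.
Proof. by move=> e; rewrite -(adjRK f) e adjRK. Qed.

Lemma left_adjoint_coproduct (I : small) (X : I -> C) (P : C)
    (inj : forall i, mor (X i) P) :
  is_coproduct inj -> is_coproduct (fun i => fmap F (inj i)).
Proof.
move=> cP Y f; have [g gP] := coproduct_lift (fun i => adjL (f i)) cP.
exists (adjR g); split=> [i|h hP].
  by apply: adjL_inj; rewrite -adjL_nat adjLK gP.
rewrite -(adjRK h); congr adjR; apply: (coproduct_ext cP) => i.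
by rewrite gP adjL_nat hP.
Qed.

End Adjunction.

Definition preserves_coproducts (C D : preadditive) (F : functor C D) : Prop :=
  forall (I : small) (X : I -> C) (P : C) (inj : forall i, mor (X i) P),
  is_coproduct inj -> is_coproduct (fun i => fmap F (inj i)).

(** The inverse at [P] is glued from the inverses at the [X i]. *)
Lemma natural_iso_coproduct (C D : preadditive) (F G : functor C D)
    (t : forall X, mor (F X) (G X)) (I : small) (X : I -> C) (P : C)
    (inj : forall i, mor (X i) P) :
  natural t -> is_coproduct (fun i => fmap F (inj i)) ->
  is_coproduct (fun i => fmap G (inj i)) ->
  (forall i, is_iso (t (X i))) -> is_iso (t P).
Proof.
move=> nt cF cG ti.
have [g gP] := coproduct_lift (fun i => fmap F (inj i) ∘ iso_inv (ti i)) cG.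
exists g; split.
  apply: (coproduct_ext cF) => i.
  by rewrite -mcompA nt mcompA gP -mcompA iso_invl mcomp1f mcompf1.
apply: (coproduct_ext cG) => i.
by rewrite -mcompA gP mcompA nt -mcompA iso_invr mcomp1f mcompf1.
Qed.

Lemma natiso_preserves_coproducts (C D : preadditive) (F G : functor C D)
    (t : forall X, mor (F X) (G X)) :
  natural t -> (forall X, is_iso (t X)) ->
  preserves_coproducts F -> preserves_coproducts G.
Proof.
move=> nt ti pF I X P inj /pF cF Y f.
have [g gP] := coproduct_lift (fun i => f i ∘ t (X i)) cF.
exists (g ∘ iso_inv (ti P)).
have e i : iso_inv (ti P) ∘ fmap G (inj i) = fmap F (inj i) ∘ iso_inv (ti (X i)).
  apply: (mono_isoK (ti P)); rewrite !mcompA iso_invr mcomp1f nt -mcompA.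
  by rewrite iso_invr mcompf1.
split=> [i|h hP]; first by rewrite -mcompA e mcompA gP -mcompA iso_invr mcompf1.
have -> : g = h ∘ t P.
  by apply: (coproduct_ext cF) => i; rewrite gP -mcompA nt mcompA hP.
by rewrite -mcompA iso_invr mcompf1.
Qed.

End Functors.

(** * Triangulated categories: exactness, fibres, homotopy colimits *)

Section Triangulated.
Variable D : triangulated.

Lemma shift_faithful (X Y : D) (f g : mor X Y) :
  fmap shift f = fmap shift g -> f = g.
Proof. exact: (natiso_faithful (unshift_shift D)). Qed.

Lemma shift_full (X Y : D) (h : mor (shift X) (shift Y)) :
  exists f : mor X Y, fmap shift f = h.
Proof. exact: (natiso_full (unshift_shift D) (shift_unshift D)). Qed.

Lemma shift_unshift_isomorphic (X : D) : isomorphic (shift (unshift X)) X.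
Proof. by exists (shift_unshift D X); exact: (ni_iso (shift_unshift D) X). Qed.

Lemma unshift_shift_isomorphic (X : D) : isomorphic (unshift (shift X)) X.
Proof. by exists (unshift_shift D X); exact: (ni_iso (unshift_shift D) X). Qed.

Lemma retract_unshift (X Y : D) : retract (shift X) (shift Y) -> retract X Y.
Proof.
move=> [i [r e]]; have [i' ei] := shift_full i; have [r' er] := shift_full r.
exists i', r'; apply: shift_faithful.
by rewrite fmapM ei er e fmap1.
Qed.

Section Triangle.
Variables (X Y Z : D) (u : mor X Y) (v : mor Y Z) (w : mor Z (shift X)).
Hypothesis t : dist u v w.

(** TR3 applied to a map from the given triangle to the triangle on [0 -> W = W], which is a rotated
    identity triangle. *)
Lemma dist_factor_l (W : D) (f : mor Y W) : f ∘ u = 0 -> exists g, f = g ∘ v.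
Proof.
move=> e; have [O zO] := (tri_additive D).1.
have sO : is_zero (shift O) by apply: fmap_is_zero (@shift_additive D) zO.
have t' : dist (0 : mor O W) (idm W) (0 : mor W (shift O)).
  apply/tr2; have -> : - fmap shift (0 : mor O W) = 0 by exact: sO.2.
  exact: tr1_id.
have [|h [hv _]] := tr3 (f := (0 : mor X O)) (g := f) t t'.
  by rewrite e mcomp0f.
by exists h; rewrite hv mcomp1f.
Qed.

Lemma dist_comp0 : v ∘ u = 0.
Proof.
have [O zO] := (tri_additive D).1.
have [|h [hv _]] := tr3 (f := idm X) (g := u) (tr1_id X zO) t.
  by rewrite mcompf1.
by rewrite -hv mcompf0.
Qed.

(** Dually, [W = W -> 0] is mapped to the given triangle. Both are rotated once for TR3, so the
    resulting map lives between shifts and is pulled back by fullness; the two signs cancel. *)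
Lemma dist_factor_r (W : D) (f : mor W Y) : v ∘ f = 0 -> exists g, f = u ∘ g.
Proof.
move=> e; have [O zO] := (tri_additive D).1.
have t1 := (tr2 _ _ _).1 (tr1_id W zO).
have t2 := (tr2 _ _ _).1 t.
have [|h [_]] := tr3 (f := f) (g := (0 : mor O Z)) t1 t2.
  by rewrite e mcomp0f.
have [g <-] := shift_full h.
rewrite fmap1 mcompfN mcompNf mcompf1 => /oppr_inj; rewrite -fmapM.
by move=> /shift_faithful ->; exists g.
Qed.

End Triangle.

(** A retract is enough for classes closed under retracts, and it can be written down from the two
    maps given by TR3. *)
Lemma cone_retract (X Y Z Y' Z' : D)
    (u : mor X Y) (v : mor Y Z) (w : mor Z (shift X))
    (u' : mor X Y') (v' : mor Y' Z') (w' : mor Z' (shift X)) (e : mor Y Y') :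
  dist u v w -> dist u' v' w' -> is_iso e -> e ∘ u = u' -> retract Z Z'.
Proof.
move=> t t' [e' [e'e ee']] eu.
have [|a [av aw]] := tr3 (f := idm X) (g := e) t t'; first by rewrite mcompf1.
have [|b [bv bw]] := tr3 (f := idm X) (g := e') t' t.
  by rewrite -eu mcompA e'e mcomp1f mcompf1.
rewrite fmap1 mcomp1f in aw; rewrite fmap1 mcomp1f in bw.
(* b ∘ a induces the identity on X and Y, so b ∘ a - 1 has square zero. *)
pose n := b ∘ a - idm Z.
have nv : n ∘ v = 0.
  by rewrite mcompBl -mcompA av mcompA bv -mcompA e'e mcompf1 mcomp1f subrr.
have wn : w ∘ n = 0 by rewrite mcompBr mcompA -bw -aw mcompf1 subrr.
have [x xw] := dist_factor_l ((tr2 _ _ _).1 t) nv.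
have nn : n ∘ n = 0 by rewrite {1}xw -mcompA wn mcompf0.
have ba : b ∘ a = idm Z + n by rewrite /n addrC subrK.
exists a, ((idm Z - n) ∘ b).
by rewrite -mcompA ba mcompDr mcompf1 mcompBl nn mcomp1f subr0 subrK.
Qed.

Lemma fibre_exists (X Y Z : D) (u : mor X Y) (v : mor Y Z) (w : mor Z (shift X)) :
  dist u v w ->
  exists (A : D) (a : mor A X) (b : mor Y (shift A)),
    isomorphic (shift A) Z /\ dist a u b.
Proof.
move=> t; have [eps [k [ke ek]]] := shift_unshift_isomorphic Z.
(* The sign of [- a0] cancels the one that TR2 introduces when the new triangle is rotated. *)
have [a0 ea] := shift_full (w ∘ eps); exists (unshift Z), (- a0), (k ∘ v).
split; first by exists eps, k.
apply/tr2; rewrite fmapN ?opprK; last exact: shift_additive.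
apply: (tr1_iso (f := idm X) (g := idm Y) (h := k)) t; try exact: is_iso_id.
- by exists eps.
- by rewrite mcomp1f mcompf1.
- by rewrite mcompf1.
by rewrite fmap1 mcomp1f ea -mcompA ek mcompf1.
Qed.

Lemma perp_r_retract (P : class D) : retract_closed (perp_r P).
Proof.
move=> X Y [i [r e]] pY W PW f.
by rewrite -(mcomp1f f) -e -mcompA (pY W PW (i ∘ f)) mcompf0.
Qed.

Lemma perp_l_retract (P : class D) : retract_closed (perp_l P).
Proof.
move=> X Y [i [r e]] pY W PW f.
by rewrite -(mcompf1 f) -e mcompA (pY W PW (f ∘ r)) mcomp0f.
Qed.

(** The map from [X] to its torsion-free part vanishes, so the identity of [X] factors through its
    torsion part. *)
Lemma torsion_aisle_perp (U V : class D) (X : D) : retract_closed U ->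
  torsion_pair U V -> (forall B, V B -> hom_zero X B) -> U X.
Proof.
move=> rU [_ _ _ dec] z; have [A [B [u [v [w [UA VB t]]]]]] := dec X.
have [|g e] := dist_factor_r t (f := idm X); first by rewrite mcompf1 (z B VB v).
by apply: rU UA; exists g, u.
Qed.

Lemma fiter_isomorphic (F : functor D D) k (X Y : D) :
  isomorphic X Y -> isomorphic (fiter F k X) (fiter F k Y).
Proof. by move=> e; elim: k => //= k; apply: fmap_isomorphic. Qed.

Lemma shiftn_isomorphic n (X Y : D) :
  isomorphic X Y -> isomorphic (shiftn X n) (shiftn Y n).
Proof. by case: n => k; apply: fiter_isomorphic. Qed.

(** [E] is the homotopy colimit of the sequence [t]; a left inverse of [d] is
    obtained by summing the defects [i j.+1 ∘ g j ∘ p k] for [j < k]. *)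
Lemma split_telescope (Z : nat -> D) (Q E V : D) (i : forall k, mor (Z k) Q)
    (t : forall k, mor (Z k) (Z k.+1)) (p : forall k, mor (Z k) V)
    (g : forall k, mor V (Z k.+1)) (d : mor Q Q) (c : mor Q E)
    (w : mor E (shift Q)) :
  @is_coproduct D nat Z Q i ->
  (forall k, d ∘ i k = i k - i k.+1 ∘ t k) -> dist d c w ->
  (forall k, p k.+1 ∘ t k = p k) -> (forall k, t k = g k ∘ p k) ->
  (forall k, p k.+1 ∘ g k = idm V) ->
  exists e : mor E V, is_iso e /\ forall k, e ∘ (c ∘ i k) = p k.
Proof.
move=> cQ di tri pt tg pg.
have [q qi] := coproduct_lift p cQ.
have qd : q ∘ d = 0.
  apply: (coproduct_ext cQ) => k.
  by rewrite -mcompA di mcompBr mcompA !qi pt subrr mcomp0f.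
have [e qe] := dist_factor_l tri qd.
have ei k : e ∘ (c ∘ i k) = p k by rewrite mcompA -qe qi.
have [r ri] := coproduct_lift
  (fun k => i k - \sum_(j < k) (i j.+1 ∘ g j ∘ p k)) cQ.
have rd : r ∘ d = idm Q.
  apply: (coproduct_ext cQ) => k.
  rewrite -mcompA di mcompBr mcompA !ri mcompBl.
  (* The terms [j < k] are compatible with [t k]; the last one becomes [i k.+1 ∘ t k], since
     [g k ∘ p k = t k]. *)
  have -> : (\sum_(j < k.+1) (i j.+1 ∘ g j ∘ p k.+1)) ∘ t k
      = \sum_(j < k) (i j.+1 ∘ g j ∘ p k) + i k.+1 ∘ t k.
    rewrite (mcomp_suml k.+1 (fun j => i j.+1 ∘ g j ∘ p k.+1)) big_ord_recr /=.
    rewrite -[_ ∘ p k.+1 ∘ _]mcompA pt -mcompA -tg; congr (_ + _).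
    by apply: eq_bigr => j _; rewrite -mcompA pt.
  by rewrite mcomp1f opprB addrK subrK.
(* By rotation [fmap shift d ∘ w = 0], and [fmap shift d] has the left inverse [fmap shift r]. *)
have w0 : w = 0.
  have := dist_comp0 ((tr2 _ _ _).1 ((tr2 _ _ _).1 tri)).
  rewrite mcompNf => /eqP; rewrite oppr_eq0 => /eqP dw.
  by rewrite -(mcomp1f w) -fmap1 -rd fmapM -mcompA dw mcompf0.
exists e; split=> //.
(* The inverse of [e]: the maps [c ∘ i k.+1 ∘ g k] from [V] to the colimit do not depend on [k]. *)
pose s := c ∘ i 1 ∘ g 0.
have ct k : c ∘ i k.+1 ∘ t k = c ∘ i k.
  have := dist_comp0 tri => /(congr1 (fun h => h ∘ i k)).
  rewrite mcomp0f -mcompA di mcompBr mcompA => /eqP.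
  by rewrite subr_eq0 => /eqP ->.
have sk k : c ∘ i k.+1 ∘ g k = s.
  elim: k => // k <-.
  by rewrite -[in RHS]ct -[RHS]mcompA tg -!mcompA pg mcompf1.
have es : e ∘ s = idm V by rewrite mcompA ei pg.
exists s; split=> //.
(* A map that kills [c] factors through [w], which is zero. *)
have : (s ∘ e - idm E) ∘ c = 0.
  apply: (coproduct_ext cQ) => k.
  have sek : s ∘ (e ∘ (c ∘ i k)) = c ∘ i k by rewrite ei -(sk k) -mcompA -tg ct.
  by rewrite -mcompA mcompBl -[s ∘ e ∘ _]mcompA sek mcomp1f subrr mcomp0f.
move=> /(dist_factor_l ((tr2 _ _ _).1 tri)) [x].
by rewrite w0 mcompf0 => /subr0_eq.
Qed.

End Triangulated.

(** * Triangle functors, shifts, and a five lemma for natural maps *)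

Definition preserves_triangles (C D : triangulated) (F : functor C D) : Prop :=
  forall (X Y Z : C) (u : mor X Y) (v : mor Y Z) (w : mor Z (shift X)),
  dist u v w -> exists w', dist (fmap F u) (fmap F v) w'.

Section TriangleFunctors.
Variables (C D : triangulated).

Lemma triangle_functor_preserves (F : functor C D) :
  triangle_functor F -> preserves_triangles F.
Proof. by move=> tF X Y Z u v w /(tf_dist tF) t; eexists; apply: t. Qed.

Lemma triangle_functor_shift (F : functor C D) (X : C) :
  triangle_functor F -> isomorphic (F (shift X)) (shift (F X)).
Proof. by move=> tF; exists (tf_shift tF X); exact: (ni_iso (tf_shift tF) X). Qed.

Lemma triangle_functor_unshift (F : functor C D) (X : C) :
  triangle_functor F -> isomorphic (F (unshift X)) (unshift (F X)).
Proof.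
move=> tF.
apply: isomorphic_trans (isomorphic_sym (unshift_shift_isomorphic _)) _.
apply: fmap_isomorphic.
apply: isomorphic_trans (isomorphic_sym (triangle_functor_shift _ tF)) _.
exact/fmap_isomorphic/shift_unshift_isomorphic.
Qed.

Lemma triangle_functor_shiftn (F : functor C D) (X : C) n :
  triangle_functor F -> isomorphic (F (shiftn X n)) (shiftn (F X) n).
Proof.
move=> tF; case: n => k /=.
  elim: k => [|k IH] /=; first exact: isomorphic_refl.
  exact: isomorphic_trans (triangle_functor_shift _ tF) (fmap_isomorphic _ IH).
apply: isomorphic_trans (triangle_functor_unshift _ tF) (fmap_isomorphic _ _).
elim: k => [|k IH] /=; first exact: isomorphic_refl.
exact: isomorphic_trans (triangle_functor_unshift _ tF) (fmap_isomorphic _ IH).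
Qed.

(** No compatibility of [t] with the shift isomorphisms of [F] and [G] is
    required, at the price of the hypotheses on [shift X] and [shift Y]. *)
Lemma natural_iso_cone (F G : functor C D) (t : forall X, mor (F X) (G X))
    (X Y Z : C) (u : mor X Y) (v : mor Y Z) (w : mor Z (shift X)) :
  additive_functor F -> additive_functor G ->
  preserves_triangles F -> preserves_triangles G -> natural t -> dist u v w ->
  is_iso (t X) -> is_iso (t Y) -> is_iso (t (shift X)) -> is_iso (t (shift Y)) ->
  is_iso (t Z).
Proof.
move=> aF aG pF pG nt t1 iX iY iX1 iY1.
have t2 := (tr2 _ _ _).1 t1; have t3 := (tr2 _ _ _).1 t2.
have [? F1] := pF _ _ _ _ _ _ t1; have [? F2] := pF _ _ _ _ _ _ t2.
have [? F3] := pF _ _ _ _ _ _ t3; have [? G1] := pG _ _ _ _ _ _ t1.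
have [? G2] := pG _ _ _ _ _ _ t2; have [? G3] := pG _ _ _ _ _ _ t3.
apply: iso_of_bijective => W.
  (* Surjectivity: [t Z ∘ m] equals [x] up to a map killed by [fmap G w]; that map comes from [G Y]
     and lifts through [t Y]. *)
  move=> x; pose k := iso_inv iX1 ∘ (fmap G w ∘ x).
  have tk : t (shift X) ∘ k = fmap G w ∘ x by rewrite mcompA iso_invr mcomp1f.
  have /(dist_factor_r F3) [m km] : fmap F (- fmap shift u) ∘ k = 0.
    apply: (mono_isoK iY1); rewrite mcompA nt -mcompA tk mcompA.
    by rewrite (dist_comp0 G3) mcomp0f mcompf0.
  have /(dist_factor_r G2) [y xy] : fmap G w ∘ (x - t Z ∘ m) = 0.
    by rewrite mcompBr mcompA -nt -mcompA -km tk subrr.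
  exists (m + fmap F v ∘ (iso_inv iY ∘ y)).
  rewrite mcompDr (mcompA (t Z)) nt -mcompA (mcompA (t Y)) iso_invr mcomp1f.
  by rewrite -xy addrC subrK.
move=> y ty.
have /(dist_factor_r F2) [g yg] : fmap F w ∘ y = 0.
  by apply: (mono_isoK iX1); rewrite mcompA nt -mcompA ty !mcompf0.
have /(dist_factor_r G1) [h gh] : fmap G v ∘ (t Y ∘ g) = 0.
  by rewrite mcompA -nt -mcompA -yg.
have gh' : g = fmap F u ∘ (iso_inv iX ∘ h).
  by apply: (mono_isoK iY);
    rewrite gh mcompA nt -mcompA (mcompA (t X)) iso_invr mcomp1f.
by rewrite yg gh' mcompA (dist_comp0 F1) mcomp0f.
Qed.

End TriangleFunctors.

Lemma compF_preserves_triangles (C D E : triangulated) (G : functor D E)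
    (F : functor C D) :
  preserves_triangles G -> preserves_triangles F ->
  preserves_triangles (compF G F).
Proof.
by move=> pG pF X Y Z u v w /pF [w' t']; have [w2 t2] := pG _ _ _ _ _ _ t'; exists w2.
Qed.

(** * Orthogonals of shifts under an adjunction *)

Section Perp.
Variables (C D : triangulated).

Lemma perp_r_shifts_iso (T T' : D) N (Y : D) : isomorphic T T' ->
  perp_r (shifts T N) Y -> perp_r (shifts T' N) Y.
Proof.
move=> i z _ [n [Nn ->]].
apply: hom_zero_iso (shiftn_isomorphic n i) (isomorphic_refl Y) _.
by apply: z; exists n.
Qed.

Lemma perp_r_adjunction (F : functor C D) (G : functor D C) (T : C) N (Y : D) :
  triangle_functor F -> adjunction F G ->
  (perp_r (shifts (F T) N) Y <-> perp_r (shifts T N) (G Y)).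
Proof.
move=> tF adj; have zP n := adj_hom_zero adj (tf_additive tF) (shiftn T n) Y.
have sF n := triangle_functor_shiftn T n tF.
split=> z _ [n [Nn ->]].
  apply/zP; apply: hom_zero_iso (isomorphic_sym (sF n)) (isomorphic_refl Y) _.
  by apply: z; exists n.
apply: hom_zero_iso (sF n) (isomorphic_refl Y) _.
by apply/zP; apply: z; exists n.
Qed.

Lemma perp_l_adjunction (F : functor C D) (G : functor D C) (T : D) N (X : C) :
  additive_functor F -> triangle_functor G -> adjunction F G ->
  (perp_l (shifts (G T) N) X <-> perp_l (shifts T N) (F X)).
Proof.
move=> aF tG adj; have zP n := adj_hom_zero adj aF X (shiftn T n).
have sG n := triangle_functor_shiftn T n tG.
split=> z _ [n [Nn ->]].
  apply/zP; apply: hom_zero_iso (isomorphic_refl X) (isomorphic_sym (sG n)) _.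
  by apply: z; exists n.
apply: hom_zero_iso (isomorphic_refl X) (sG n) _.
by apply/zP; apply: z; exists n.
Qed.

End Perp.

(** * Lifting a t-structure along a conservative functor *)

Section Lift.
Variables (D1 D2 : triangulated) (F : functor D1 D2) (G : functor D2 D1).
Variables (U V : class D1).
Hypothesis adj : adjunction F G.
Hypothesis aF : additive_functor F.
Hypothesis tG : triangle_functor G.
Hypothesis coprodG : preserves_coproducts G.
Hypothesis conservG : forall Y, is_zero (G Y) -> is_zero Y.
Hypothesis coprod2 : has_coproducts D2.
Hypothesis tUV : t_structure U V.
Hypothesis rU : retract_closed U.
Hypothesis rV : retract_closed V.
Hypothesis GFU : forall X, U X -> U (G (F X)).

Let orth X Y : U X -> V Y -> hom_zero X Y.
Proof. by case: tUV => -[_ _ + _] _; apply. Qed.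

Let shU X : U X -> U (shift X).
Proof. by case: tUV => _; apply. Qed.

(** Only the universal property is recorded, not a triangle, so that the same [B] can serve at every
    stage of the iteration. *)
Definition reflection (X B : D1) (p : mor X B) : Prop :=
  [/\ V B, forall W (f : mor X W), V W -> exists g, f = g ∘ p
    & forall W (g : mor B W), V W -> g ∘ p = 0 -> g = 0].

(** Factorizations exist because [A] is orthogonal to [W], and are unique because [shift A] is. *)
Lemma reflection_dist (A X B : D1) (a : mor A X) (b : mor X B)
    (w : mor B (shift A)) : dist a b w -> U A -> V B -> reflection b.
Proof.
move=> t UA VB; split=> // W f VW.
  by apply: (dist_factor_l t); apply: orth.
move=> /(dist_factor_l ((tr2 _ _ _).1 t)) [y ->].
by rewrite (orth (shU UA) VW y) mcomp0f.
Qed.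

(** [Y'] is the cone of [F A -> Y], where [A -> G Y] is the coreflection in
    [U]; then [G t] factors through the reflection [p], which stays that of
    [G Y']. *)
Lemma reflection_step (B : D1) (Y : D2) (p : mor (G Y) B) : reflection p ->
  exists (Y' : D2) (t : mor Y Y') (p' : mor (G Y') B) (g : mor B (G Y')),
  [/\ reflection p', p' ∘ fmap G t = p, fmap G t = g ∘ p, p' ∘ g = idm B
    & forall W (f : mor Y W), V (G W) -> exists f', f = f' ∘ t].
Proof.
move=> [VB extp injp]; case: (tUV) => -[_ _ _ /(_ (G Y))] + _.
move=> [A [B' [a [b [w [UA VB' tab]]]]]].
have [Y' [t [w' ts]]] := tr1_cone (adjR adj a).
have Gts := tf_dist tG ts; have UGFA := GFU UA.
(* The map [a] factors through [fmap G (adjR adj a)], which [fmap G t] kills. *)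
have ta : fmap G t ∘ a = 0.
  by rewrite -[a](adjLK adj) mcompA -fmapM (dist_comp0 ts) fmap0 ?mcomp0f //;
    exact: tf_additive tG.
have [g0 tg0] := dist_factor_l tab ta.
have [h bh] := extp _ b VB'.
have tg : fmap G t = (g0 ∘ h) ∘ p by rewrite tg0 bh mcompA.
have [p' pp'] := dist_factor_l Gts (orth UGFA VB (p ∘ fmap G (adjR adj a))).
exists Y', t, p', (g0 ∘ h); split=> //.
- split=> // W.
    move=> f VW; have [x fx] := extp _ (f ∘ fmap G t) VW; exists x.
    apply: subr0_eq.
    have : (f - x ∘ p') ∘ fmap G t = 0.
      by rewrite mcompBl -mcompA -pp' fx subrr.
    move=> /(dist_factor_l ((tr2 _ _ _).1 Gts)) [y ->].
    by rewrite (orth (shU UGFA) VW y) mcomp0f.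
  by move=> x VW xp; apply: injp => //; rewrite pp' mcompA xp mcomp0f.
- apply/subr0_eq/(injp _ _ VB).
  by rewrite mcompBl mcomp1f -mcompA -tg -pp' subrr.
move=> W f VW; apply: (dist_factor_l ts).
by apply: (adj_hom_zero adj aF A W).2; apply: orth.
Qed.

(** [Y'] is the homotopy colimit of the iterated steps. As [G] preserves coproducts and triangles,
    [G Y'] is the colimit of a sequence whose maps factor through [B], and [split_telescope]
    identifies it with [B]. *)
Lemma reflection_lift (B : D1) (Y : D2) (p : mor (G Y) B) : reflection p ->
  exists (Y' : D2) (c : mor Y Y') (e : mor (G Y') B),
  [/\ is_iso e, e ∘ fmap G c = p
    & forall W (f : mor Y W), V (G W) -> exists f', f = f' ∘ c].
Proof.
move=> rp.
(* An object is bundled with its reflection in the fixed [B], so that the step can be iterated by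
   choice. *)
pose stage := {Y : D2 & {p : mor (G Y) B | reflection p}}.
pose ob (s : stage) : D2 := projT1 s.
pose pr (s : stage) : mor (G (ob s)) B := proj1_sig (projT2 s).
have step (s : stage) : {s' : stage & {t : mor (ob s) (ob s')
    & {g : mor B (G (ob s')) | [/\ pr s' ∘ fmap G t = pr s,
        fmap G t = g ∘ pr s, pr s' ∘ g = idm B
      & forall W (f : mor (ob s) W), V (G W) -> exists f', f = f' ∘ t]}}}.
  have := reflection_step (proj2_sig (projT2 s)).
  move=> /constructive_indefinite_description [Y'].
  move=> /constructive_indefinite_description [t].
  move=> /constructive_indefinite_description [p'].
  move=> /constructive_indefinite_description [g [rp' e1 e2 e3 e4]].
  by exists (existT _ Y' (exist _ p' rp')), t, g.
pose s := fix s k : stage :=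
  if k is k'.+1 then projT1 (step (s k')) else existT _ Y (exist _ p rp).
pose t k : mor (ob (s k)) (ob (s k.+1)) := projT1 (projT2 (step (s k))).
pose g k : mor B (G (ob (s k.+1))) := proj1_sig (projT2 (projT2 (step (s k)))).
have stP k : [/\ pr (s k.+1) ∘ fmap G (t k) = pr (s k),
    fmap G (t k) = g k ∘ pr (s k), pr (s k.+1) ∘ g k = idm B
  & forall W (f : mor (ob (s k)) W), V (G W) -> exists f', f = f' ∘ t k].
  exact: (proj2_sig (projT2 (projT2 (step (s k))))).
have [Q [i cQ]] := coprod2 (fun k => ob (s k)).
have [d di] := coproduct_lift (fun k => i k - i k.+1 ∘ t k) cQ.
have [E [c [w tri]]] := tr1_cone d.
have [||||e [ei ec]] := split_telescope (p := fun k => pr (s k)) (g := g)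
  (t := fun k => fmap G (t k)) (coprodG cQ) _ (tf_dist tG tri).
- move=> k; rewrite -!fmapM di (tf_additive tG) fmapN //; exact: tf_additive tG.
- by move=> k; have [] := stP k.
- by move=> k; have [] := stP k.
- by move=> k; have [] := stP k.
exists E, (c ∘ i 0), e; split=> //; first by rewrite fmapM; exact: (ec 0).
move=> W f VW.
have ext k (h : mor (ob (s k)) W) : {h' | h = h' ∘ t k}.
  by apply: constructive_indefinite_description; have [_ _ _] := stP k; apply.
(* Compatible extensions of [f] to all stages; glued on the coproduct they kill [d], hence factor
   through the cone. *)
pose h := fix h k : mor (ob (s k)) W :=
  if k is k'.+1 then proj1_sig (ext k' (h k')) else f.
have hS k : h k = h k.+1 ∘ t k by exact: (proj2_sig (ext k (h k))).
have [q qi] := coproduct_lift h cQ.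
have /(dist_factor_l tri) [f' qf'] : q ∘ d = 0.
  apply: (coproduct_ext cQ) => k.
  by rewrite -mcompA di mcompBr mcompA !qi -hS subrr mcomp0f.
by exists f'; rewrite mcompA -qf'; exact: (esym (qi 0)).
Qed.

Lemma lift_t_structure : t_structure (fun Y => U (G Y)) (fun Y => V (G Y)).
Proof.
have rG (X Y : D2) : retract X Y -> retract (G X) (G Y).
  by move=> [i [r e]]; exists (fmap G i), (fmap G r); rewrite -fmapM e fmap1.
case: (tUV) => -[_ _ _ dec] _; split; last first.
  move=> X /shU; apply: retract_closed_iso => //; apply: isomorphic_sym.
  exact: triangle_functor_shift.
split.
- by move=> A X /summand_retract/rG; apply: rU.
- by move=> A X /summand_retract/rG; apply: rV.
- move=> X Y UX VY f; have [A [B [a [b [w [UA VB t]]]]]] := dec (G X).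
  have rb := reflection_dist t UA VB.
  have [E [c [e [ei _ ext]]]] := reflection_lift rb.
  have [f' ->] := ext _ f VY.
  (* Here [G X] lies in [U], so its reflection in [V] vanishes. *)
  have zB : is_zero B.
    apply: is_zero_id; have [_ _ inj] := rb; apply: inj => //.
    by rewrite mcomp1f; apply: orth.
  have zE : is_zero E.
    apply/conservG/is_zero_id/(mono_isoK ei).
    by rewrite (zB.1 _ (e ∘ _)) mcompf0.
  by rewrite (zE.1 _ c) mcompf0.
move=> Y; have [A [B [a [b [w [UA VB t]]]]]] := dec (G Y).
have [E [c [e [ei ec _]]]] := reflection_lift (reflection_dist t UA VB).
have [Z [v [x tc]]] := tr1_cone c.
have [Y' [u [x' [iZ tu]]]] := fibre_exists tc.
exists Y', E, u, c, x'; split=> //; last first.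
  by apply: retract_closed_iso VB => //; apply: isomorphic_sym; exists e.
(* [G Y'] and [A] are compared after one shift, as cones of [fmap G c] and of [b]. *)
apply: rU UA; apply: retract_unshift.
have [i [r ri]] := cone_retract (tf_dist tG tc) ((tr2 _ _ _).1 t) ei ec.
have [j [k [kj _]]] : isomorphic (shift (G Y')) (G Z).
  apply: isomorphic_trans (isomorphic_sym (triangle_functor_shift _ tG)) _.
  exact: fmap_isomorphic.
exists (i ∘ j), (k ∘ r).
by rewrite -mcompA (mcompA r) ri mcomp1f.
Qed.

End Lift.

(** * Tensor-invertible objects and their shifts *)

Section Invertible.
Variables (C : preadditive) (M : sym_monoidal C).
Notation "A ⊗ B" := (tens M A B).
Notation "f ⊗h g" := (tensh M f g).

Definition invertible (L : C) : Prop :=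
  exists L', isomorphic (L ⊗ L') (munit M).

Lemma tensh_iso (A A' B B' : C) (f : mor A A') (g : mor B B') :
  is_iso f -> is_iso g -> is_iso (f ⊗h g).
Proof.
move=> [f' [f1 f2]] [g' [g1 g2]]; exists (f' ⊗h g').
by rewrite -!tenshM f1 f2 g1 g2 !tensh1.
Qed.

Lemma tens_isomorphic (A A' B B' : C) :
  isomorphic A A' -> isomorphic B B' -> isomorphic (A ⊗ B) (A' ⊗ B').
Proof. by move=> [f fi] [g gi]; exists (f ⊗h g); apply: tensh_iso. Qed.

Lemma braid_isomorphic (A B : C) : isomorphic (A ⊗ B) (B ⊗ A).
Proof. by exists (mbraid M A B), (mbraid M B A); rewrite !mbraid_sym. Qed.

(** Reassociate and contract [L ⊗ L']. With the braiding this makes tensoring with [L] an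
    equivalence. *)
Lemma tens_r_cancel (L L' : C) (i : mor (L ⊗ L') (munit M)) :
  is_iso i -> natiso (compF (tens_r M L') (tens_r M L)) (idF C).
Proof.
move=> ii.
exists (fun X => mrunit M X ∘ (idm X ⊗h i) ∘ massoc M X L L').
  move=> X Y f /=.
  rewrite -mcompA massoc_nat tensh1 mcompA -(mcompA (mrunit M Y)) -tenshM.
  rewrite mcomp1f mcompf1 -{1}(mcompf1 f) -{1}(mcomp1f i) tenshM mcompA.
  by rewrite mrunit_nat !mcompA.
move=> X; apply: is_iso_comp (massoc_iso M _ _ _).
by apply: is_iso_comp (mrunit_iso M X) _; apply: tensh_iso (is_iso_id X) ii.
Qed.

Lemma invertible_sym (L L' : C) :
  isomorphic (L ⊗ L') (munit M) -> isomorphic (L' ⊗ L) (munit M).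
Proof. exact: isomorphic_trans (braid_isomorphic _ _). Qed.

Lemma tens_r_faithful (L X Y : C) (f g : mor X Y) : invertible L ->
  f ⊗h idm L = g ⊗h idm L -> f = g.
Proof. by move=> [L' [i ii]]; apply: (natiso_faithful (tens_r_cancel ii)). Qed.

Lemma tens_r_full (L X Y : C) (h : mor (X ⊗ L) (Y ⊗ L)) : invertible L ->
  exists f, f ⊗h idm L = h.
Proof.
move=> [L' i]; have [j jj] := invertible_sym i; case: i => i ii.
exact: (natiso_full (tens_r_cancel ii) (tens_r_cancel jj)).
Qed.

Lemma tens_r_esssurj (L X : C) : invertible L ->
  exists Y, isomorphic (Y ⊗ L) X.
Proof.
move=> [L' /invertible_sym [j jj]]; exists (X ⊗ L').
by exists (tens_r_cancel jj X); exact: (ni_iso (tens_r_cancel jj) X).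
Qed.

Lemma invertible_unit : invertible (munit M).
Proof. by exists (munit M), (mlunit M (munit M)); apply: mlunit_iso. Qed.

End Invertible.

Section InvertibleShift.
Variables (D : closed_tt) (L : D).
Let M := tt_mon D.

Lemma tens_shift_l (X Y : D) : isomorphic (shift X ⊗ Y) (shift (X ⊗ Y)).
Proof. exact: triangle_functor_shift (tt_tens_r Y). Qed.

Lemma tens_shift_r (X Y : D) : isomorphic (X ⊗ shift Y) (shift (X ⊗ Y)).
Proof. exact: triangle_functor_shift (tt_tens_l X). Qed.

Lemma tens_unshift_l (X Y : D) : isomorphic (unshift X ⊗ Y) (unshift (X ⊗ Y)).
Proof. exact: triangle_functor_unshift (tt_tens_r Y). Qed.

Lemma tens_unshift_r (X Y : D) : isomorphic (X ⊗ unshift Y) (unshift (X ⊗ Y)).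
Proof. exact: triangle_functor_unshift (tt_tens_l X). Qed.

(** The inverse of [shift L] is [unshift L']: the two shifts cancel. *)
Lemma invertible_shift : invertible M L -> invertible M (shift L).
Proof.
move=> [L' i]; exists (unshift L').
apply: isomorphic_trans (tens_shift_l _ _) _.
apply: isomorphic_trans (fmap_isomorphic _ (tens_unshift_r _ _)) _.
exact: isomorphic_trans (shift_unshift_isomorphic _) i.
Qed.

Lemma invertible_unshift : invertible M L -> invertible M (unshift L).
Proof.
move=> [L' i]; exists (shift L').
apply: isomorphic_trans (tens_unshift_l _ _) _.
apply: isomorphic_trans (fmap_isomorphic _ (tens_shift_r _ _)) _.
exact: isomorphic_trans (unshift_shift_isomorphic _) i.
Qed.

End InvertibleShift.

Lemma strong_monoidal_invertible (C D : closed_tt) (F : functor C D) (L : C) :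
  strong_monoidal F -> invertible (tt_mon C) L -> invertible (tt_mon D) (F L).
Proof.
move=> sm [L' i]; exists (F L').
apply: (isomorphic_trans (Y := F (L ⊗ L'))).
  by exists (sm_tens sm L L'); apply: sm_tens_iso.
apply: isomorphic_trans (fmap_isomorphic F i) _.
by apply: isomorphic_sym; exists (sm_unit sm); apply: sm_unit_iso.
Qed.

(** * The projection formula for the unit of [D2] *)

Section ProjectionFormula.
Variables (D1 D2 : closed_tt) (F : functor D1 D2) (G : functor D2 D1).
Hypothesis adj : adjunction F G.
Hypothesis sm : strong_monoidal F.
Hypothesis tF : triangle_functor F.
Hypothesis tG : triangle_functor G.
Hypothesis coprodG : preserves_coproducts G.
Hypothesis gen : forall X : D1, Loc (tunit D1) X.

Let R : D1 := G (tunit D2).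
Let muV (A B : D1) := iso_inv (sm_tens_iso sm A B).

Let muV_nat (A A' B B' : D1) (f : mor A A') (g : mor B B') :
  muV A' B' ∘ fmap F (f ⊗h g) = (fmap F f ⊗h fmap F g) ∘ muV A B.
Proof.
apply: (mono_isoK (sm_tens_iso sm A' B')).
by rewrite !mcompA iso_invr mcomp1f sm_tens_nat -mcompA iso_invr mcompf1.
Qed.

(** The transpose of [F (R ⊗ X) ≅ F R ⊗ F X -> F X], where the counit contracts [F R] to the
    unit. *)
Definition projection (X : D1) : mor (R ⊗ X) (G (F X)) :=
  adjL adj (mlunit (tt_mon D2) (F X) ∘ (adj_counit adj (tunit D2) ⊗h idm (F X))
    ∘ muV R X).

Lemma projection_natural :
  natural (F := tens_l (tt_mon D1) R) (G := compF G F) projection.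
Proof.
move=> X Y f /=; rewrite /projection adjL_nat adjL_nat_r; congr adjL.
rewrite -mcompA muV_nat fmap1 !mcompA; congr (_ ∘ _).
rewrite -mlunit_nat -!mcompA -!tenshM; congr (_ ∘ _).
by rewrite !mcompf1 !mcomp1f.
Qed.

(** On maps of the form [y ⊗h idm X] the projection acts through the transpose of [y], which reduces
    its bijectivity to that of the adjunction. *)
Lemma projection_tens (X W : D1) (y : mor W R) :
  projection X ∘ (y ⊗h idm X)
  = adjL adj (mlunit (tt_mon D2) (F X) ∘ (adjR adj y ⊗h idm (F X)) ∘ muV W X).
Proof.
rewrite /projection adjL_nat; congr adjL.
rewrite -mcompA muV_nat fmap1 mcompA; congr (_ ∘ _).
by rewrite -mcompA -tenshM mcomp1f.
Qed.

(** Yoneda on the objects [W ⊗ L]: tensoring with [L] and with [F L] is fully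
    faithful. *)
Lemma projection_invertible (L : D1) :
  invertible (tt_mon D1) L -> is_iso (projection L).
Proof.
move=> iL; have iFL := strong_monoidal_invertible sm iL.
have zero_tens (D : closed_tt) (A B E : D) : (0 : mor A B) ⊗h idm E = 0.
  exact: (fmap0 _ _ (tf_additive (tt_tens_r E))).
apply: iso_of_bijective => W; have [W1 [j [j' [_ jj']]]] := tens_r_esssurj W iL.
  (* Surjectivity: transpose [x ∘ j], strip the factor [F L], and transpose back. *)
  move=> x; pose x' := adjR adj (x ∘ j) ∘ sm_tens sm W1 L.
  have [z zx] := tens_r_full (iso_inv (mlunit_iso (tt_mon D2) (F L)) ∘ x') iFL.
  exists ((adjL adj z ⊗h idm L) ∘ j').
  rewrite mcompA projection_tens adjRK zx mcompA iso_invr mcomp1f.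
  by rewrite /x' /muV -mcompA iso_invr mcompf1 adjLK -mcompA jj' mcompf1.
move=> y py; have [y' yy'] := tens_r_full (y ∘ j) iL.
suff y0 : y' = 0.
  by rewrite -(mcompf1 y) -jj' mcompA -yy' y0 zero_tens mcomp0f.
rewrite -(adjLK adj y').
suff -> : adjR adj y' = 0 by rewrite /adjL fmap0 ?mcomp0f //; apply: tf_additive tG.
apply: (tens_r_faithful iFL); rewrite zero_tens.
apply: (mono_isoK (mlunit_iso (tt_mon D2) (F L))); rewrite mcompf0.
rewrite -[LHS]mcompf1 -(iso_invl (sm_tens_iso sm W1 L)) mcompA.
suff -> : mlunit (tt_mon D2) (F L) ∘ (adjR adj y' ⊗h idm (F L))
    ∘ iso_inv (sm_tens_iso sm W1 L) = 0 by rewrite mcomp0f.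
apply: (adjL_inj (adj := adj)); rewrite -[LHS]projection_tens yy' mcompA py mcomp0f.
by rewrite /adjL fmap0 ?mcomp0f //; apply: tf_additive tG.
Qed.

Lemma tens_r_coproduct (D : closed_tt) (A : D) :
  preserves_coproducts (tens_r (tt_mon D) A).
Proof. exact: left_adjoint_coproduct (ihom_adj A). Qed.

(** Closedness provides the right adjoint of [- ⊗ A]; the braiding carries the conclusion over to
    [A ⊗ -]. *)
Lemma tens_l_coproduct (D : closed_tt) (A : D) :
  preserves_coproducts (tens_l (tt_mon D) A).
Proof.
have braid_nat : natural (F := tens_r (tt_mon D) A) (G := tens_l (tt_mon D) A)
    (fun X => mbraid (tt_mon D) X A).
  by move=> X Y f; apply: mbraid_nat.
refine (natiso_preserves_coproducts braid_nat _ (@tens_r_coproduct D A)).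
by move=> X; exists (mbraid (tt_mon D) A X); rewrite !mbraid_sym.
Qed.

Lemma projection_isomorphic (X Y : D1) :
  isomorphic X Y -> is_iso (projection X) -> is_iso (projection Y).
Proof.
move=> [f fi] pX; have [f' [f'f ff']] := fi.
have -> : projection Y = fmap G (fmap F f) ∘ projection X ∘ (idm R ⊗h f').
  have /= <- := projection_natural f.
  by rewrite -mcompA -tenshM ff' mcomp1f tensh1 mcompf1.
apply: is_iso_comp; last by apply: tensh_iso (is_iso_id R) _; exists f.
by apply: is_iso_comp pX; apply/fmap_iso/fmap_iso.
Qed.

(** Dévissage: both sides preserve triangles and coproducts in [X], which reduces the claim to
    invertible objects. *)
Lemma projection_iso (X : D1) : is_iso (projection X).
Proof.
(* The maps [projection (X[n])] are not known to be shifts of one another, so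
   the localizing class is made stable under shifts by tensoring with all the
   invertible objects. *)
pose P (X : D1) := forall L, invertible (tt_mon D1) L -> is_iso (projection (X ⊗ L)).
have Pshift Z : P Z -> P (shift Z).
  move=> PZ L iL; apply: (projection_isomorphic (X := Z ⊗ shift L)).
    apply: isomorphic_trans (tens_shift_r _ _) _.
    exact: isomorphic_sym (tens_shift_l _ _).
  exact/PZ/invertible_shift.
have aR := tf_additive (tt_tens_l R); have aF := tf_additive tF.
have aG := tf_additive tG.
have nat L : natural (F := compF (tens_l (tt_mon D1) R) (tens_r (tt_mon D1) L))
    (G := compF (compF G F) (tens_r (tt_mon D1) L))
    (fun Z => projection (Z ⊗ L)).
  by move=> Y Z f; apply: (projection_natural (f ⊗h idm L)).
suff PX : P X.
  apply: (projection_isomorphic (X := X ⊗ tunit D1)).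
    by exists (mrunit (tt_mon D1) X); apply: mrunit_iso.
  exact/PX/invertible_unit.
refine (@gen X P _ _ _).
- split=> //.
  + move=> Z zZ L _.
    have zL : is_zero (Z ⊗ L) by apply: (fmap_is_zero (tf_additive (tt_tens_r L))).
    have zl : is_zero (R ⊗ (Z ⊗ L)) := fmap_is_zero aR zL.
    have zr : is_zero (G (F (Z ⊗ L))) := fmap_is_zero aG (fmap_is_zero aF zL).
    by exists 0; rewrite (zl.2 _ (idm _)) (zr.2 _ (idm _)) mcomp0f mcompf0.
  + move=> Y Z i PY L iL; apply: (projection_isomorphic (X := Y ⊗ L)).
      exact: tens_isomorphic i (isomorphic_refl L).
    exact: PY.
  + move=> Z PZ L iL; apply: (projection_isomorphic (X := Z ⊗ unshift L)).
      apply: isomorphic_trans (tens_unshift_r _ _) _.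
      exact: isomorphic_sym (tens_unshift_l _ _).
    exact/PZ/invertible_unshift.
  + move=> Z1 Z2 Z3 u v w t P1 P2 L iL.
    have tL := tf_additive (tt_tens_r L).
    have pL := triangle_functor_preserves (tt_tens_r L).
    apply: (natural_iso_cone _ _ _ _ (nat L) t); do ?[exact: P1 | exact: P2 |
      exact: Pshift].
    * exact: compF_additive.
    * by do 2?apply: compF_additive.
    * exact: compF_preserves_triangles (triangle_functor_preserves (tt_tens_l R)) pL.
    * apply: compF_preserves_triangles pL.
      by apply: compF_preserves_triangles; apply: triangle_functor_preserves.
- move=> I Z Q inj cQ PZ L iL.
  have cL := @tens_r_coproduct D1 L _ _ _ _ cQ.
  apply: (natural_iso_coproduct (nat L)).
  + exact: (@tens_l_coproduct D1 R _ _ _ _ cL).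
  + exact: (coprodG (left_adjoint_coproduct adj cL)).
  + by move=> i; apply: PZ.
move=> L iL; apply: (projection_isomorphic (X := L)).
  by apply: isomorphic_sym; exists (mlunit (tt_mon D1) L); apply: mlunit_iso.
exact: projection_invertible.
Qed.

End ProjectionFormula.

(** * Lifting t-structures when the units are silting *)

Section SiltingUnits.
Variables (D1 D2 : closed_tt) (F : functor D1 D2) (G : functor D2 D1).
Hypothesis adj : adjunction F G.
Hypothesis sm : strong_monoidal F.
Hypothesis tF : triangle_functor F.
Hypothesis tG : triangle_functor G.
Hypothesis coprodG : preserves_coproducts G.
Hypothesis gen : forall X : D1, Loc (tunit D1) X.
Hypothesis silting1 : silting (tunit D1).
Hypothesis silting2 : silting (tunit D2).

Let unit_iso : isomorphic (tunit D2) (F (tunit D1)).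
Proof. by exists (sm_unit sm); apply: sm_unit_iso. Qed.

(** The unit of [D2] is the image of that of [D1], so no shift of it maps nontrivially to [Y]; thus
    [Y] lies in both the aisle and the coaisle. *)
Lemma silting_unit_conservative (Y : D2) : is_zero (G Y) -> is_zero Y.
Proof.
move=> zY.
have z N : perp_r (shifts (tunit D2) N) Y.
  apply: perp_r_shifts_iso (isomorphic_sym unit_iso) _.
  by apply/(perp_r_adjunction _ _ _ tF adj) => W _ f; apply: zY.1.
case: silting2 => _ [[_ _ orth _] _].
by apply: is_zero_id; apply: orth; apply: z.
Qed.

Lemma tens_unit_aisle (U V : class D1) (X : D1) : t_structure U V ->
  retract_closed U -> U X -> U (G (tunit D2) ⊗ X).
Proof.
move=> [tUV shU] rU UX; apply: (torsion_aisle_perp rU tUV) => B VB.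
have aX := tf_additive (tt_tens_r X).
apply/(adj_hom_zero (ihom_adj X) aX).
case: silting1 => _ [[_ _ orth1 _] _]; apply: orth1.
  apply/(perp_r_adjunction _ _ _ tF adj)/(perp_r_shifts_iso unit_iso).
  case: silting2 => _ [tp2 _].
  (* The unit lies in its own aisle: the coaisle is orthogonal to its shift by 0. *)
  apply: (torsion_aisle_perp (@perp_r_retract _ _) tp2) => Z; apply.
  by exists 0.
(* Maps from the unit shifted by [n >= 0] to [ihom X B] are maps from [X] shifted by [n], an object
   of [U], to [B]. *)
move=> _ [n [n0 ->]].
apply/(adj_hom_zero (ihom_adj X) aX).
have i : isomorphic (shiftn X n) (tens_r (tt_mon D1) X (shiftn (tunit D1) n)).
  apply: isomorphic_sym.
  apply: isomorphic_trans (triangle_functor_shiftn _ _ (tt_tens_r X)) _.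
  apply: shiftn_isomorphic.
  by exists (mlunit (tt_mon D1) X); apply: mlunit_iso.
apply: (hom_zero_iso i (isomorphic_refl B)).
case: tUV => _ _ orth _; apply: orth VB.
case: n n0 {i} => // k _ /=.
by elim: k => //= k; apply: shU.
Qed.

(** Stated for arbitrary t-structures with retract-closed classes, to cover the silting and the
    cosilting case at once. *)
Lemma silting_unit_lift (U V : class D1) : has_coproducts D2 ->
  t_structure U V -> retract_closed U -> retract_closed V ->
  t_structure (fun Y => U (G Y)) (fun Y => V (G Y)).
Proof.
move=> coprod2 tUV rU rV.
apply: (lift_t_structure adj (tf_additive tF) tG) => //.
  exact: silting_unit_conservative.
move=> X UX; apply: retract_closed_iso (tens_unit_aisle tUV rU UX) => //.
by exists (projection adj sm X); apply: projection_iso.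
Qed.

End SiltingUnits.

(** * The induced silting and cosilting t-structures *)

Lemma t_structure_same (D : triangulated) (U V U' V' : class D) :
  same_class U U' -> same_class V V' -> t_structure U V -> t_structure U' V'.
Proof.
move=> eU eV [[sU sV orth dec] shU]; split; last by move=> X /eU/shU/eU.
split.
- by move=> A X s /eU/(sU _ _ s)/eU.
- by move=> A X s /eV/(sV _ _ s)/eV.
- by move=> X Y /eU UX /eV; apply: orth.
move=> X; have [A [B [u [v [w [/eU UA /eV VB t]]]]]] := dec X.
by exists A, B, u, v, w.
Qed.

Theorem corollary3p6 (D1 D2 : closed_tt)
  (prod1 : has_products D1) (coprod1 : has_coproducts D1)
  (prod2 : has_products D2) (coprod2 : has_coproducts D2)
  (phi_up phi_shriek : functor D1 D2) (phi_low : functor D2 D1)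
  (phi_up_tri : triangle_functor phi_up)
  (phi_low_tri : triangle_functor phi_low)
  (phi_shriek_tri : triangle_functor phi_shriek)
  (adj_up_low : monoidal_adjunction phi_up phi_low)
  (adj_low_shriek : adjunction phi_low phi_shriek)
  (silting1 : silting (tunit D1)) (silting2 : silting (tunit D2))
  (generates1 : forall X : D1, Loc (tunit D1) X) :
  (forall T1 T1' : D1,
     silting_equiv T1 T1' -> silting_equiv (phi_up T1) (phi_up T1')) /\
  (forall C1 C1' : D1,
     cosilting_equiv C1 C1' ->
     cosilting_equiv (phi_shriek C1) (phi_shriek C1')).
Proof.
have [adj sm] := adj_up_low.
have coprod_low : preserves_coproducts phi_low.
  exact: left_adjoint_coproduct adj_low_shriek.
have lift := silting_unit_lift adj sm phi_up_tri phi_low_tri coprod_low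
  generates1 silting1 silting2 coprod2.
have up T N Y := perp_r_adjunction T N Y phi_up_tri adj.
have shriek T N Y := perp_l_adjunction T N Y (tf_additive phi_low_tri)
  phi_shriek_tri adj_low_shriek.
split=> [T T' [sT sT' eU eV] | T T' [sT sT' eU eV]].
  (* Being silting is part of [silting_equiv], so it has to be shown for the images too: their
     classes are preimages under [phi_low]. *)
  have st S : silting S -> silting (phi_up S).
    move=> [_ /lift tS]; split=> //.
    apply: t_structure_same (tS (@perp_r_retract _ _) (@perp_r_retract _ _)) => Y;
      exact: iff_sym (up _ _ _).
  split; [exact: st | exact: st | |] => Y.
    by apply: iff_trans (up _ _ _) (iff_trans (eU _) (iff_sym (up _ _ _))).
  by apply: iff_trans (up _ _ _) (iff_trans (eV _) (iff_sym (up _ _ _))).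
have st S : cosilting S -> cosilting (phi_shriek S).
  move=> [_ /lift tS]; split=> //.
  apply: t_structure_same (tS (@perp_l_retract _ _) (@perp_l_retract _ _)) => Y;
    exact: iff_sym (shriek _ _ _).
split; [exact: st | exact: st | |] => Y.
  by apply: iff_trans (shriek _ _ _) (iff_trans (eU _) (iff_sym (shriek _ _ _))).
by apply: iff_trans (shriek _ _ _) (iff_trans (eV _) (iff_sym (shriek _ _ _))).
Qed.
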